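(* For $n\ge1$, $$|\Pi_n(134/2)|=1+\sum_{k=1}^{\lfloor n/2\rfloor}\sum_{f=0}^{n-2k}\binom{n-f-k-1}{k-1}\binom{2k+f}{f}(2k-1)!!,$$ where $(2k-1)!!=(2k)!/(2^kk!)$ is the number of perfect matchings of a $2k$-element set.
   Context: The standardization of a set partition of a finite set $S\subset\mathbb{Z}_{>0}$ replaces the $i$-th smallest element of $S$ by $i$. A set partition $\pi$ of $[n]$ contains $\tau\vdash[k]$ if for some $S\subseteq[n]$ the standardization of the restriction of $\pi$ to $S$ is $\tau$; otherwise it avoids $\tau$. $\Pi_n(\tau)$ is the set of partitions of $[n]$ avoiding $\tau$. $134/2$ is the partition of $[4]$ with blocks $\{1,3,4\},\{2\}$. *)

(* Defs.v *)
From mathcomp Require Import all_boot.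

Set Implicit Arguments.
Unset Strict Implicit.
Unset Printing Implicit Defensive.

(* The ground set [n] = {1, ..., n} is represented by 'I_n, where the ordinal  *)
(* with value i stands for the integer i.+1.                                  *)
Definition set_partition (n : nat) (pi : {set {set 'I_n}}) : bool :=
  partition pi [set: 'I_n].

Definition restriction (n : nat) (pi : {set {set 'I_n}}) (S : {set 'I_n}) :
    {set {set 'I_n}} :=
  [set B :&: S | B in pi] :\ set0.

(* If x is the i-th smallest element of S, this is i.-1, i.e. the value of    *)
(* the ordinal that stands for i.                                             *)
Definition rank_in (n : nat) (S : {set 'I_n}) (x : 'I_n) : nat :=
  #|[set y in S | y < x]|.

(* Meaningful for a partition sigma of a set S with #|S| = k: in that case    *)
(* rank_in S is the increasing bijection from S to {0, ..., k.-1}.            *)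
Definition standardization (n k : nat) (S : {set 'I_n})
    (sigma : {set {set 'I_n}}) : {set {set 'I_k}} :=
  [set [set j : 'I_k | [exists x in B, rank_in S x == j]] | B : {set 'I_n} in sigma].

Definition contains (n k : nat) (pi : {set {set 'I_n}})
    (tau : {set {set 'I_k}}) : bool :=
  [exists S : {set 'I_n},
    (#|S| == k) && (standardization k S (restriction pi S) == tau)].

Definition avoids (n k : nat) (pi : {set {set 'I_n}})
    (tau : {set {set 'I_k}}) : bool :=
  ~~ contains pi tau.

Definition avoiders (n k : nat) (tau : {set {set 'I_k}}) :
    {set {set {set 'I_n}}} :=
  [set pi | set_partition pi & avoids pi tau].

(* The element i of {1, 2, 3, 4}. *)
Definition pt4 (i : nat) : 'I_4 := inord i.-1.

Definition pat134_2 : {set {set 'I_4}} :=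
  [set [set pt4 1; pt4 3; pt4 4]; [set pt4 2]].

(* (2k-1)!! = (2k)! / (2^k k!); the division is exact by odd_dfactE. *)
Definition odd_dfact (k : nat) : nat := (2 * k)`! %/ (2 ^ k * k`!).

Lemma odd_dfact_prod (k : nat) :
  (\prod_(i < k) (2 * i + 1)) * (2 ^ k * k`!) = (2 * k)`!.
Proof.
elim: k => [|k IHk]; first by rewrite big_ord0.
rewrite big_ord_recr /= mulnS !factS -IHk expnS addn1.
move: (\prod_(i < k) _) (2 ^ k) (k`!) => p a b.
have -> : (2 * k).+2 = 2 * k.+1 by rewrite mulnS.
by rewrite [2 * a * _]mulnACA mulnCA (mulnC p) -[_ * p * _]mulnA.
Qed.

Lemma odd_dfactE (k : nat) : odd_dfact k * (2 ^ k * k`!) = (2 * k)`!.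
Proof. by rewrite divnK // -odd_dfact_prod dvdn_mull. Qed.

Lemma set_partition_pat134_2 : set_partition pat134_2.
Proof.
apply/and3P; split.
- apply/eqP/setP=> x; rewrite /cover /pat134_2 bigcup_setU !big_set1 !inE.
  by case: x => -[|[|[|[|//]]]] hx; rewrite -!val_eqE /= !inordK.
- apply/trivIsetP=> A B; rewrite !inE => /orP[]/eqP-> /orP[]/eqP-> //;
    rewrite ?eqxx // => _; rewrite -setI_eq0; apply/eqP/setP=> x; rewrite !inE;
    by case: x => -[|[|[|[|//]]]] hx; rewrite -!val_eqE /= !inordK.
- rewrite !inE; apply/negP=> /orP[]/eqP/setP.
  + by move/(_ (pt4 1)); rewrite !inE eqxx.
  + by move/(_ (pt4 2)); rewrite !inE eqxx.
Qed.

(* Main.v *)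
Require Import Defs.
From mathcomp Require Import all_boot zify.

(* A partition avoids 134/2 iff every block is an interval together with at   *)
(* most one further element to its right.  Read [n] from right to left and    *)
(* label each element by the number of elements to the right of the maximum   *)
(* of its block: prepending an element never changes the other labels.  The   *)
(* new element may start a block, join any block of size one, or join the     *)
(* block of the element just read.  Deciding at its first (rightmost) element *)
(* whether a block will remain a singleton turns this growth rule into a      *)
(* lattice path count, in which the f singletons and k larger blocks form an  *)
(* involution on 2k+f points (binomial times double factorial) and the        *)
(* remaining n-2k-f elements prolong the k intervals (weak compositions).     *)

(** * Label words *)

(** Avoiders correspond bijectively to [words n], the canonical label words without a gap:
    [choicesP] identifies the letters that can be prepended, and [avoiders_words] with
    [label_partition_inj] gives the bijection. The choices lead to states described by the number of
    singleton blocks and one flag, so [size_iter_extend] turns the enumeration into [grow_count].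
    Selecting in advance the singletons that will be joined ([grow_countE]) gives [path_count]. Its
    recurrence is solved by [weight], an involution count ([open_involutionsS]) times a number of
    weak compositions ([weightS], [path_countE]). *)

(* Number of ways to prepend n elements to a word with u blocks of size one;  *)
(* c tells whether the block of the leftmost element has size at least two.   *)
Fixpoint grow_count (n u : nat) (c : bool) : nat :=
  if n is n'.+1 then
    grow_count n' u.+1 false + u * grow_count n' u.-1 true
      + c * grow_count n' u true
  else 1.

Definition singles (s : seq nat) : seq nat :=
  [seq x <- undup s | count_mem x s == 1].

Definition active (s : seq nat) : bool := 1 < count_mem (head 0 s) s.

Definition choices (s : seq nat) : seq nat :=
  size s :: singles s ++ (if active s then [:: head 0 s] else [::]).

Definition extend (ss : seq (seq nat)) : seq (seq nat) :=
  [seq x :: s | s <- ss, x <- choices s].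

(* A fresh label is the number of elements already read, so that words with   *)
(* the same kernel coincide.                                                  *)
Fixpoint canonical (s : seq nat) : bool :=
  if s is x :: s' then canonical s' && ((x == size s') || (x \in s')) else true.

Lemma canonical_lt s x : canonical s -> x \in s -> x < size s.
Proof.
elim: s x => // y s IHs x /= /andP[/IHs lts ys].
rewrite inE => /predU1P[->|/lts /ltnW //].
by case/orP: ys => [/eqP->|/lts /ltnW].
Qed.

Lemma canonical_size s : canonical s -> size s \notin s.
Proof. by move=> cs; apply/negP => /(canonical_lt _ _ cs); rewrite ltnn. Qed.

Lemma mem_singles s x : (x \in singles s) = (count_mem x s == 1).
Proof.
rewrite mem_filter mem_undup andb_idr // -has_pred1 has_count.
by move/eqP->.
Qed.

Lemma mem_choices s x : x \in choices s ->
  [\/ x = size s, count_mem x s = 1 | x = head 0 s /\ 1 < count_mem x s].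
Proof.
rewrite inE mem_cat mem_singles => /or3P[/eqP->|/eqP->|]; try by constructor.
by rewrite /active; case: ifP => // act; rewrite inE => /eqP->; constructor 3.
Qed.

(** The three kinds of choices are disjoint because they occur in [s] zero times, once and at least
    twice respectively. *)
Lemma uniq_choices s : canonical s -> uniq (choices s).
Proof.
move=> cs; have nss := canonical_size _ cs.
have us : uniq (singles s) by rewrite filter_uniq ?undup_uniq.
have n1 : size s \notin singles s by rewrite mem_singles (count_memPn nss).
rewrite /choices /active; case: ifP => act; last by rewrite cats0 /= n1.
have h1 : head 0 s \notin singles s.
  by rewrite mem_singles; case: (count _ _) act => [|[]].
rewrite cats1 /= mem_rcons inE negb_or n1 rcons_uniq h1 us !andbT.
by apply: contraTneq act => <-; rewrite (count_memPn nss).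
Qed.

Lemma size_singles_cons x s :
  size (singles (x :: s)) =
    if x \in s then size (singles s) - (count_mem x s == 1)
    else (size (singles s)).+1.
Proof.
rewrite /singles !size_filter /=; case: ifP => [xs|/negbT nxs].
  have cx : 0 < count_mem x s by rewrite -has_count has_pred1.
  have -> : nat_of_bool (count_mem x s == 1) =
      count (fun y => (y == x) && (count_mem y s == 1)) (undup s).
    case: eqP => [c1|c1]; last first.
      rewrite (@eq_count _ _ pred0) ?count_pred0 // => y /=.
      by apply/negP => /andP[/eqP-> /eqP].
    rewrite (@eq_count _ _ (pred1 x)) ?count_uniq_mem ?undup_uniq //.
      by rewrite mem_undup xs.
    by move=> y /=; case: eqP => // ->; rewrite c1.
  rewrite -[X in _ = X - _]size_filter.
  rewrite -(count_predC (pred1 x)) !count_filter.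
  rewrite addKn; apply: eq_count => y /=.
  rewrite (eq_sym x); case: (y =P x) => [->|_] //=.
  by rewrite add1n eqSS; case: (count _ _) cx.
rewrite /= eqxx (count_memPn nxs) /= add1n; congr _.+1.
apply: eq_in_count => y; rewrite mem_undup => ys.
by case: (x =P y) ys nxs => // -> ->.
Qed.

(** The innermost extension is peeled off, so the seed list has to be arbitrary. The three summands
    of [grow_count] are a fresh letter, a letter occurring once, and the repeated head. *)
Lemma size_iter_extend n ss : all canonical ss ->
  size (iter n extend ss) =
  \sum_(s <- ss) grow_count n (size (singles s)) (active s).
Proof.
elim: n ss => [|n IHn] ss css.
  by rewrite /= sum1_size.
have cext : all canonical (extend ss).
  apply/allP => t /allpairsPdep[s [x [sss xs ->]]] /=.
  rewrite (allP css) //=; have [->|c1|[_ c1]] := mem_choices _ _ xs.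
  - by rewrite eqxx.
  - by rewrite -has_pred1 has_count c1 orbT.
  - by rewrite -has_pred1 has_count (ltnW c1) orbT.
rewrite iterSr IHn // big_allpairs_dep; apply: eq_big_seq => s sss.
have cs := allP css _ sss; have nss := canonical_size _ cs.
rewrite big_cons big_cat /= addnA; congr (_ + _ + _).
- rewrite size_singles_cons (negbTE nss) /active /= eqxx.
  by rewrite (count_memPn nss).
- rewrite -[X in _ = X * _]sum1_size big_distrl; apply: eq_big_seq => x.
  rewrite mem_singles => /eqP c1.
  have xs : x \in s by rewrite -has_pred1 has_count c1.
  by rewrite size_singles_cons /active /= eqxx xs c1 mul1n subn1.
case: ifP => act; last by rewrite big_nil.
have hs : head 0 s \in s by rewrite -has_pred1 has_count (ltnW act).
have cn1 : (count_mem (head 0 s) s == 1) = false.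
  by apply/eqP => c1; move: act; rewrite /active c1.
rewrite big_seq1 mul1n size_singles_cons hs cn1 subn0 /active /= eqxx.
by congr grow_count; rewrite add1n ltnS ltnW.
Qed.

(** * Words without an occurrence of the pattern *)

Definition has_gap (s : seq nat) : Prop :=
  exists a b c d : nat, [/\ a < b < c, c < d < size s,
    nth 0 s a = nth 0 s c, nth 0 s a = nth 0 s d & nth 0 s a <> nth 0 s b].

Lemma has_gap_cons x s : has_gap s -> has_gap (x :: s).
Proof.
by move=> [a [b [c [d [abc cds ac ad ab]]]]]; exists a.+1, b.+1, c.+1, d.+1.
Qed.

Lemma count_gt1P (x : nat) (s : seq nat) : reflect
  (exists c d, [/\ c < d, d < size s, nth 0 s c = x & nth 0 s d = x])
  (1 < count_mem x s).
Proof.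
apply: (iffP idP).
  elim: s => //= y s IHs; case: eqP => [->|_]; last first.
    by case/IHs => c [d [cd ds xc xd]]; exists c.+1, d.+1.
  rewrite add1n ltnS -has_count has_pred1 => xs.
  exists 0, (index x s).+1; split=> //=; last exact: nth_index.
  by rewrite ltnS index_mem.
elim: s => [[c [d []]]|y s IHs] //= [[|c] [[|d] [//= cd ds xc xd]]].
  rewrite xc eqxx ltnS -has_count has_pred1 -xd; exact: mem_nth.
by rewrite (leq_trans _ (leq_addl _ _)) //; apply: IHs; exists c, d.
Qed.

(** A new gap must use the prepended letter as its smallest element, so [x] has to occur twice in
    [s] already. It is then harmless only if [x] is the head of [s]. *)
Lemma choicesP x s : canonical s -> ~ has_gap s ->
  reflect (canonical (x :: s) /\ ~ has_gap (x :: s)) (x \in choices s).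
Proof.
move=> cs gs; have nss := canonical_size _ cs.
apply: (iffP idP) => [xs|[]].
  split.
    rewrite /= cs /=; have [->|c1|[_ c1]] := mem_choices _ _ xs.
    - by rewrite eqxx.
    - by rewrite -has_pred1 has_count c1 orbT.
    - by rewrite -has_pred1 has_count (ltnW c1) orbT.
  case=> a [[|b] [[|c] [[|d] [abc cds ac ad ab]]]]; try lia.
  case: a abc cds ac ad ab => [|a] /= abc cds ac ad ab; last first.
    by apply: gs; exists a, b, c, d.
  have cnt : 1 < count_mem x s.
    by apply/count_gt1P; exists c, d; split=> //; lia.
  have [xE|c1|[xE _]] := mem_choices _ _ xs.
  - by move: cnt; rewrite xE (count_memPn nss).
  - by move: cnt; rewrite c1.
  case: b abc ab => [_|b abc ab]; first by rewrite xE nth0.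
  (* The head of [s] also carries the label [x] and can replace the prepended letter, so the gap was
     already in [s]. *)
  by apply: gs; exists 0, b.+1, c, d; rewrite nth0 -xE.
rewrite /= cs /= inE => /orP[->//|xs] gxs; rewrite mem_cat mem_singles.
have [c1|c1] := leqP (count_mem x s) 1.
  have -> : count_mem x s == 1 by rewrite eqn_leq c1 -has_count has_pred1.
  by rewrite orbT.
apply/orP; right; apply/orP; right.
have xE : head 0 s = x; last by rewrite /active xE c1 inE.
apply/eqP/negP => /negP hx; have /count_gt1P[c [d [cd ds xc xd]]] := c1.
(* The old head, at position 1, differs from [x] and separates the new letter from its two later
   copies. *)
apply: gxs; exists 0, 1, c.+1, d.+1; rewrite /= nth0.
have c0 : 0 < c by case: c xc {cd} => // xc; case/eqP: hx; rewrite -nth0.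
by split; rewrite ?ltnS ?c0 ?cd //; apply/eqP; rewrite eq_sym.
Qed.

Definition words (n : nat) : seq (seq nat) := iter n extend [:: [::]].

Lemma mem_words n s :
  s \in words n <-> [/\ size s = n, canonical s & ~ has_gap s].
Proof.
elim: n s => [|n IHn] s.
  rewrite inE; split => [/eqP->|[/size0nil-> //]].
  by split=> // -[a [b [c [d []]]]]; rewrite /= ltn0 andbF.
split=> [/allpairsPdep[t [x [tn xt ->]]]|].
  have [ts ct gt] := (IHn t).1 tn; have [cxt gxt] := choicesP _ _ ct gt xt.
  by split=> //=; rewrite ts.
case: s => [[//]|x s [[sn] cxs gxs]]; apply/allpairsPdep; exists s, x.
have cs : canonical s by case/andP: cxs.
have gs : ~ has_gap s by move=> /(has_gap_cons x).
by split=> //; [apply/IHn | apply/choicesP].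
Qed.

Lemma uniq_words n : uniq (words n).
Proof.
elim: n => // n IHn; apply: allpairs_uniq_dep => //.
  by move=> s /mem_words[_ cs _]; apply: uniq_choices.
by move=> [s x] [t y] _ _ /= [-> ->].
Qed.

Lemma size_words n : size (words n) = grow_count n 0 false.
Proof. by rewrite size_iter_extend // big_seq1. Qed.

(** * One canonical word for each kernel *)

Lemma canonical_inj s t : canonical s -> canonical t -> size s = size t ->
  (forall i j, i < size s -> j < size s ->
    (nth 0 s i == nth 0 s j) = (nth 0 t i == nth 0 t j)) -> s = t.
Proof.
elim: s t => [|x s IHs] [|y t] // /andP[cs xs] /andP[ct yt] [sz] E.
have st : s = t by apply: IHs => // i j si sj; apply: (E i.+1 j.+1).
subst t; congr (_ :: s).
have E0 i : i < size s -> (x == nth 0 s i) = (y == nth 0 s i).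
  by move=> si; apply: (E 0 i.+1).
have xy : (x \in s) = (y \in s).
  apply/(nthP 0)/(nthP 0) => -[] // i is_ /eqP; rewrite eq_sym => xi.
    by exists i => //; apply/eqP; rewrite eq_sym -E0.
  by exists i => //; apply/eqP; rewrite eq_sym E0.
case/orP: xs xy => [/eqP->|xs].
  rewrite (negbTE (canonical_size _ cs)) => /esym/negbT ys.
  by case/orP: yt => [/eqP//|]; rewrite (negbTE ys).
move=> _; apply/esym/eqP; have xi : index x s < size s by rewrite index_mem.
by rewrite -{1}(nth_index 0 xs) -E0 // nth_index.
Qed.

Lemma canonical_exists (T : eqType) n (g : nat -> T) :
  exists s, [/\ size s = n, canonical s & forall i j, i < n -> j < n ->
    (nth 0 s i == nth 0 s j) = (g i == g j)].
Proof.
elim: n g => [|n IHn] g; first by exists [::].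
have [s [sn cs sg]] := IHn (fun i => g i.+1).
have [x cx xg] : exists2 x, canonical (x :: s) &
    forall j, j < n -> (x == nth 0 s j) = (g 0 == g j.+1).
  have [i gi|ng] := pickP (fun i : 'I_n => g 0 == g i.+1).
    exists (nth 0 s i); first by rewrite /= cs mem_nth ?orbT // sn.
    by move=> j jn; rewrite sg // (eqP gi).
  exists (size s); first by rewrite /= cs eqxx.
  move=> j jn; rewrite (ng (Ordinal jn)); apply/negP => /eqP sE.
  by have := canonical_size _ cs; rewrite sE mem_nth // sn.
exists (x :: s); split=> //=; first by rewrite sn.
move=> [|i] [|j] //=; rewrite ?ltnS => ilt jlt.
- by rewrite !eqxx.
- exact: xg.
- by rewrite eq_sym [RHS]eq_sym; apply: xg.
exact: sg.
Qed.

(** * Occurrences of 134/2 *)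

Lemma rank_in_lt n (S : {set 'I_n}) (x y : 'I_n) :
  x \in S -> x < y -> rank_in S x < rank_in S y.
Proof.
move=> xS xy; apply/proper_card/properP; split.
  apply/subsetP => z; rewrite !inE => /andP[-> zx]; exact: ltn_trans zx xy.
by exists x; rewrite !inE ?xS ?ltnn.
Qed.

Lemma rank_in_lt_inv n (S : {set 'I_n}) (x y : 'I_n) :
  rank_in S x < rank_in S y -> x < y.
Proof.
apply: contraLR; rewrite -!leqNgt => yx; apply/subset_leq_card/subsetP => z.
rewrite !inE => /andP[-> zy]; exact: leq_trans zy yx.
Qed.

Lemma rank_in_card n (S : {set 'I_n}) (x : 'I_n) :
  x \in S -> rank_in S x < #|S|.
Proof.
move=> xS; apply/proper_card/properP; split.
  by apply/subsetP => z; rewrite !inE => /andP[].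
by exists x; rewrite // !inE xS ltnn.
Qed.

Lemma pt4E i (j : 'I_4) : 0 < i < 5 -> (j == pt4 i) = (i == j.+1).
Proof.
move=> i5; rewrite /pt4 -val_eqE /= inordK; lia.
Qed.

(** Applied to the ranks of four increasing points of a set with at most four elements: it forces
    the ranks to be 0, 1, 2, 3 and the cardinality to be 4. *)
Lemma ltn_chain4 p q r s m : p < q -> q < r -> r < s -> s < m -> m <= 4 ->
  [/\ p = 0, q = 1, r = 2, s = 3 & m = 4].
Proof. by move=> *; split; lia. Qed.

Lemma contains134_2P n (pi : {set {set 'I_n}}) : set_partition pi -> reflect
  (exists a b c d : 'I_n, [/\ a < b < c, c < d,
    pblock pi a = pblock pi c, pblock pi a = pblock pi d &
    pblock pi a <> pblock pi b])
  (contains pi pat134_2).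
Proof.
move=> ppi; have [/eqP cov triv n0] := and3P ppi.
have mem_cov x : x \in cover pi by rewrite cov.
apply: (iffP existsP).
  case=> S /andP[_ /eqP std].
  have block B : B \in pat134_2 -> exists2 B0, B0 \in pi &
      forall j, (j \in B) = [exists x in B0 :&: S, rank_in S x == j].
    rewrite -std => /imsetP[_ /setD1P[_ /imsetP[B0 piB0 ->]] ->].
    by exists B0 => // j; rewrite inE.
  have [A piA Aj] : _ := block _ (set21 _ _).
  have [A' piA' A'j] : _ := block _ (set22 _ _).
  have := Aj (pt4 1); rewrite !inE eqxx.
  case/esym/exists_inP => a /setIP[aA aS] /eqP ra.
  have := Aj (pt4 3); rewrite !inE eqxx !orbT.
  case/esym/exists_inP => c /setIP[cA cS] /eqP rc.
  have := Aj (pt4 4); rewrite !inE eqxx !orbT.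
  case/esym/exists_inP => d /setIP[dA dS] /eqP rd.
  have := A'j (pt4 2); rewrite !inE eqxx.
  case/esym/exists_inP => b /setIP[bA' bS] /eqP rb.
  exists a, b, c, d; rewrite (def_pblock triv piA aA).
  rewrite (def_pblock triv piA cA) (def_pblock triv piA dA).
  have lt x y : rank_in S x < rank_in S y -> x < y by apply: rank_in_lt_inv.
  split=> //; rewrite ?lt // ?ra ?rb ?rc ?rd /pt4 ?inordK //.
  (* If [b] lay in the block of [a], the standardized block would contain the point 2. *)
  move=> AE; have := Aj (pt4 2); rewrite !inE !pt4E // /pt4 !inordK //=.
  move/esym/existsP; apply; exists b.
  by rewrite inE bS AE mem_pblock mem_cov rb /pt4 inordK.
move=> [a [b [c [d [/andP[lt_ab lt_bc] lt_cd ac ad ab]]]]].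
set A := pblock pi a in ac ad ab; set A' := pblock pi b in ab.
have aA : a \in A by rewrite mem_pblock.
have cA : c \in A by rewrite ac mem_pblock.
have dA : d \in A by rewrite ad mem_pblock.
have bA' : b \in A' by rewrite mem_pblock.
have disj x : x \in A -> x \in A' -> False.
  move=> xA xA'; apply: ab; rewrite -[A](def_pblock triv _ xA) ?pblock_mem //.
  by rewrite (def_pblock triv _ xA') ?pblock_mem.
have bA : (b \in A) = false by apply/negP => /disj.
have aA' : (a \in A') = false by apply/negP; apply: disj.
have cA' : (c \in A') = false by apply/negP; apply: disj.
have dA' : (d \in A') = false by apply/negP; apply: disj.
pose S : {set 'I_n} := a |: (b |: (c |: [set d])); exists S.
have aS : a \in S by rewrite !inE eqxx.
have bS : b \in S by rewrite !inE eqxx !orbT.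
have cS : c \in S by rewrite !inE eqxx !orbT.
have dS : d \in S by rewrite !inE eqxx !orbT.
have S4 : #|S| <= 4.
  by rewrite /S !cardsU1 cards1; do 3 case: (_ \notin _).
have [ra rb rc rd cardS] := ltn_chain4 _ _ _ _ _
  (rank_in_lt _ _ _ _ aS lt_ab)
  (rank_in_lt _ _ _ _ bS lt_bc) (rank_in_lt _ _ _ _ cS lt_cd)
  (rank_in_card _ _ _ dS) S4.
rewrite cardS eqxx /=.
have restE : restriction pi S = [set A :&: S; A' :&: S].
  apply/setP => X; rewrite !inE; apply/idP/idP.
    case/andP => X0 /imsetP[B piB XE]; move: X0; rewrite {}XE.
    case/set0Pn => x /setIP[xB]; rewrite !inE.
    rewrite -(def_pblock triv piB xB).
    by case/or4P => /eqP->; rewrite -?ac -?ad ?eqxx ?orbT.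
  have restB B : B \in pi -> B :&: S \in [set B :&: S | B in pi].
    by move=> piB; apply/imsetP; exists B.
  case/orP => /eqP->; rewrite restB ?pblock_mem // andbT; apply/set0Pn.
    by exists a; rewrite inE aA.
  by exists b; rewrite inE bA'.
have stdE (B : {set 'I_n}) (j : 'I_4) :
  [exists x in B :&: S, rank_in S x == j] =
    [|| (a \in B) && (j == 0 :> nat), (b \in B) && (j == 1 :> nat),
        (c \in B) && (j == 2 :> nat) | (d \in B) && (j == 3 :> nat)].
  apply/exists_inP/idP => [[x /setIP[xB xS] /eqP<-]|].
    move: xS xB; rewrite !inE => /or4P[]/eqP->->; rewrite ?ra ?rb ?rc ?rd;
    by rewrite ?eqxx ?orbT.
  by case/or4P => /andP[xB /eqP->]; [exists a|exists b|exists c|exists d];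
    rewrite ?inE ?xB ?eqxx ?orbT ?ra ?rb ?rc ?rd.
rewrite /standardization restE imsetU1 imset_set1; apply/eqP.
congr [set _; _]; apply/setP => j; rewrite inE stdE !inE !pt4E //.
  by rewrite aA bA cA dA; case: j => -[|[|[|[]]]].
by rewrite aA' bA' cA' dA'; case: j => -[|[|[|[]]]].
Qed.

(** * From label words to partitions *)

Definition label_partition n (s : seq nat) : {set {set 'I_n}} :=
  preim_partition (fun i : 'I_n => nth 0 s i) [set: 'I_n].

Lemma label_partitionP n s : set_partition (label_partition n s).
Proof. exact: preim_partitionP. Qed.

Lemma pblock_label_partition n s (i j : 'I_n) :
  (pblock (label_partition n s) i == pblock (label_partition n s) j) =
  (nth 0 s i == nth 0 s j).
Proof.
have /and3P[/eqP cov triv _] := label_partitionP n s.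
rewrite eq_pblock ?cov // pblock_equivalence_partition ?inE //.
by split=> // /eqP->.
Qed.

Lemma avoids_label_partition s :
  avoids (label_partition (size s) s) pat134_2 <-> ~ has_gap s.
Proof.
rewrite /avoids; split=> [/negP av [a [b [c [d [abc cds ac ad ab]]]]]|gap].
  have [as_ bs cs ds] : [/\ a < size s, b < size s, c < size s & d < size s].
    by split; lia.
  apply: av; apply/contains134_2P; first exact: label_partitionP.
  exists (Ordinal as_), (Ordinal bs), (Ordinal cs), (Ordinal ds).
  split=> //=; [lia | ..]; apply/eqP; rewrite pblock_label_partition;
    by apply/eqP.
apply/negP => /contains134_2P[]; first exact: label_partitionP.
move=> a [b [c [d [abc cd /eqP ac /eqP ad /eqP ab]]]]; apply: gap.
exists a, b, c, d; rewrite !pblock_label_partition in ac ad ab.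
by split; rewrite ?cd ?ltn_ord //; apply/eqP.
Qed.

Lemma avoiders_words n :
  0 < n -> avoiders n pat134_2 =i [seq label_partition n s | s <- words n].
Proof.
case: n => // n _ pi; rewrite inE; apply/andP/mapP; last first.
  move=> [s /mem_words[sn cs gs] ->]; split; first exact: label_partitionP.
  by rewrite -sn; apply/avoids_label_partition.
move=> [ppi av].
(* Each point is labelled by its block, and the canonical word with this kernel is taken. *)
have [s [sn cs sg]] := canonical_exists _ n.+1 (fun i => pblock pi (inord i)).
have piE : pi = label_partition n.+1 s.
  rewrite -[LHS](preim_partition_pblock ppi); apply: eq_in_imset => x _.
  by apply/setP => y; rewrite !inE sg ?ltn_ord // !inord_val.
exists s => //; apply/mem_words; split=> //.
by apply/avoids_label_partition; rewrite sn -piE.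
Qed.

Lemma label_partition_inj n : {in words n &, injective (label_partition n)}.
Proof.
move=> s t /mem_words[sn cs _] /mem_words[tn ct _] st.
apply: canonical_inj => //; first by rewrite tn.
rewrite sn => i j lti ltj.
have := pblock_label_partition n s (Ordinal lti) (Ordinal ltj).
by rewrite st pblock_label_partition /= => ->.
Qed.

(** * Lattice paths *)

(* Like grow_count, but h only counts the blocks of size one that have to be  *)
(* joined later on, whence the final condition h = 0.                         *)
Fixpoint path_count (n h : nat) (c : bool) : nat :=
  if n is n'.+1 then
    path_count n' h false + path_count n' h.+1 false
      + h * path_count n' h.-1 true + c * path_count n' h true
  else h == 0.

Lemma sum_binS (F : nat -> nat) u H : u < H ->
  \sum_(h < H.+1) 'C(u.+1, h) * F h =
  \sum_(h < H) 'C(u, h) * F h + \sum_(h < H) 'C(u, h) * F h.+1.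
Proof.
move=> uH; rewrite big_ord_recl bin0.
under eq_bigr => i _ do rewrite lift0 binS mulnDl.
rewrite big_split /= addnA; congr (_ + _).
rewrite -[in RHS](@big_mkord _ 0 addn H xpredT (fun h => 'C(u, h) * F h)).
case: H uH => // H uH; rewrite big_nat_recl // big_mkord bin0.
by rewrite big_ord_recr /= bin_small // addn0.
Qed.

(** Choose the [h] of the [u] present singletons that will be joined later. Pascal's rule
    ([sum_binS]) decides this for a fresh singleton, and absorption handles a join. Any [H] above
    [u] will do, as the other binomials vanish. *)
Lemma grow_countE n u c H : u < H ->
  grow_count n u c = \sum_(h < H) 'C(u, h) * path_count n h c.
Proof.
elim: n u c H => [|n IHn] u c [//|H] uH /=.
  rewrite big_ord_recl bin0 big1 // => i _.
  by rewrite /= muln0.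
rewrite (IHn _ _ H.+2) // (IHn u true H.+1) //.
under [RHS]eq_bigr => i _ do rewrite 3!mulnDr.
rewrite 3!big_split /= (sum_binS (fun h => path_count n h false)) //.
congr (_ + _ + _ + _); last first.
  by rewrite big_distrr /=; apply: eq_bigr => i _; rewrite mulnCA.
case: u uH => [|u] uH.
  rewrite mul0n big1 // => i _; case: (nat_of_ord i) => [|j].
    by rewrite mul0n muln0.
  by rewrite bin0n.
rewrite (IHn _ _ H) //= big_ord_recl mul0n muln0 add0n big_distrr /=.
apply: eq_bigr => i _; rewrite -[bump 0 i]/(i.+1) -[0 + i]/(nat_of_ord i).
by rewrite mulnA (mul_bin_diag u.+1) mulnCA mulnA.
Qed.

(* Number of weak compositions of N into g parts. *)
Definition weak_comps (N g : nat) : nat :=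
  if g is g'.+1 then 'C(N + g', g') else N == 0.

Lemma weak_comps0 g : weak_comps 0 g = 1.
Proof. by case: g => //= g; rewrite add0n binn. Qed.

Lemma weak_compsS N g :
  weak_comps N.+1 g.+1 = weak_comps N g.+1 + weak_comps N.+1 g.
Proof.
case: g => [|g] /=; first by rewrite !bin0.
by rewrite addSn binS addnS addSn.
Qed.

Arguments weak_comps : simpl never.

(* Perfect matchings of 2k+2h points in which h prescribed points are matched *)
(* to points outside the prescribed ones.                                     *)
Definition open_matchings (h k : nat) : nat :=
  'C(2 * k + h, h) * h`! * odd_dfact k.

Lemma open_matchingsE h k :
  open_matchings h k * (2 ^ k * k`!) = (2 * k + h)`!.
Proof.
rewrite /open_matchings -mulnA odd_dfactE -mulnA.
by have := bin_fact (leq_addl (2 * k) h); rewrite addnK.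
Qed.

Lemma open_matchingsS h k : 0 < h + k ->
  open_matchings h k =
    (0 < k) * open_matchings h.+1 k.-1 + h * open_matchings h.-1 k.
Proof.
move=> hk; have P0 : 0 < 2 ^ k * k`! by rewrite muln_gt0 expn_gt0 fact_gt0.
apply/eqP; rewrite -(eqn_pmul2r P0) open_matchingsE mulnDl.
rewrite -(mulnA (0 < k)) -(mulnA h).
have -> : h * (open_matchings h.-1 k * (2 ^ k * k`!)) = h * (2 * k + h.-1)`!.
  by rewrite open_matchingsE.
case: k hk P0 => [|k] hk _.
  by case: h hk => // h _; rewrite mul0n factS.
rewrite mul1n expnS factS /=.
have -> : open_matchings h.+1 k * (2 * 2 ^ k * (k.+1 * k`!)) =
          2 * k.+1 * (2 * k + h.+1)`!.
  by rewrite -open_matchingsE; move: (open_matchings _ _) (2 ^ k) (k`!); nia.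
case: h hk => [|h] hk.
  by rewrite mul0n !addn0 mulnS !addSn add0n factS addn1.
have -> : 2 * k.+1 + h.+1 = (2 * k + h.+2).+1 by lia.
rewrite factS /=; have -> : 2 * k.+1 + h = 2 * k + h.+2 by lia.
by rewrite -mulnDl; apply/eqP; congr (_ * _); lia.
Qed.

(* The same with f additional fixed points. *)
Definition open_involutions (h k f : nat) : nat :=
  'C(h + 2 * k + f, f) * open_matchings h k.

(** The first free point is fixed, opens a pair, or closes one; this is Pascal's rule combined with
    [open_matchingsS]. *)
Lemma open_involutionsS h k f : 0 < h + 2 * k + f ->
  open_involutions h k f =
    (0 < f) * open_involutions h k f.-1
    + (0 < k) * open_involutions h.+1 k.-1 f
    + h * open_involutions h.-1 k f.
Proof.
rewrite /open_involutions => m0.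
have E1 : (0 < k) * ('C(h.+1 + 2 * k.-1 + f, f) * open_matchings h.+1 k.-1) =
          'C((h + 2 * k + f).-1, f) * ((0 < k) * open_matchings h.+1 k.-1).
  case: k m0 => [|k] _ /=; first by rewrite !mul0n muln0.
  by rewrite !mul1n; congr ('C(_, _) * _); lia.
have E2 : h * ('C(h.-1 + 2 * k + f, f) * open_matchings h.-1 k) =
          'C((h + 2 * k + f).-1, f) * (h * open_matchings h.-1 k).
  case: h {E1} m0 => [|h] _ /=; first by rewrite !mul0n muln0.
  by rewrite mulnCA.
rewrite E1 E2 -[RHS]addnA -mulnDr.
(* With only fixed points left, [open_matchingsS] does not apply. *)
have [hk|] := posnP (h + k).
  have -> : h = 0 by lia.
  have -> : k = 0 by lia.
  case: f m0 {E1 E2} => [m0|f _]; first lia.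
  by rewrite !mul0n muln0 addn0 mul1n muln0 !add0n !binn.
move=> hk; rewrite -open_matchingsS //.
case: f {E1 E2} m0 => [|f] _; first by rewrite mul0n !bin0.
by rewrite mul1n -mulnDl !addnS /= binS addnC.
Qed.

(* The paths counted by path_count n h c that create f singletons and k other *)
(* blocks: the elements which are neither the last nor the last but one of    *)
(* their block are distributed over the k+h+c intervals.                      *)
Definition weight (n h k f : nat) (c : bool) : nat :=
  if h + 2 * k + f <= n then
    weak_comps (n - (h + 2 * k + f)) (k + h + c) * open_involutions h k f
  else 0.

Lemma weight_gt n h k f c : n < h + 2 * k + f -> weight n h k f c = 0.
Proof. by rewrite /weight ltnNge; case: ifP. Qed.

(** The next element is a point of the involution or, if [c] holds, may prolong the current
    interval. The three involution cases share the factor [weak_comps N (k + h)]; prolonging is the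
    other term of [weak_compsS]. *)
Lemma weightS n h k f c :
  weight n.+1 h k f c =
    (0 < f) * weight n h k f.-1 false + (0 < k) * weight n h.+1 k.-1 f false
    + h * weight n h.-1 k f true + c * weight n h k f true.
Proof.
have [en|en] := ltnP n.+1 (h + 2 * k + f).
  have z1 : (0 < f) * weight n h k f.-1 false = 0.
    by case: f en => // f en; rewrite weight_gt ?muln0 //; lia.
  have z2 : (0 < k) * weight n h.+1 k.-1 f false = 0.
    by case: k en {z1} => // k en; rewrite weight_gt ?muln0 //; lia.
  have z3 : h * weight n h.-1 k f true = 0.
    by case: h en {z1 z2} => // h en; rewrite weight_gt ?muln0 //; lia.
  by rewrite z1 z2 z3 !weight_gt ?muln0 //; lia.
set N := n.+1 - (h + 2 * k + f).
have E1 : (0 < f) * weight n h k f.-1 false =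
    weak_comps N (k + h) * ((0 < f) * open_involutions h k f.-1).
  case: f en @N => [|f] en N; first by rewrite !mul0n muln0.
  rewrite !mul1n /weight ifT /=; last by lia.
  by rewrite addn0; congr (weak_comps _ _ * _); lia.
have E2 : (0 < k) * weight n h.+1 k.-1 f false =
    weak_comps N (k + h) * ((0 < k) * open_involutions h.+1 k.-1 f).
  case: k en @N {E1} => [|k] en N; first by rewrite !mul0n muln0.
  rewrite !mul1n /weight ifT /=; last by lia.
  by congr (weak_comps _ _ * _); lia.
have E3 : h * weight n h.-1 k f true =
    weak_comps N (k + h) * (h * open_involutions h.-1 k f).
  case: h en @N {E1 E2} => [|h] en N; first by rewrite !mul0n muln0.
  rewrite /weight ifT /=; last by lia.
  by rewrite mulnCA; congr (weak_comps _ _ * _); lia.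
rewrite E1 E2 E3 -!mulnDr {E1 E2 E3} /weight en -/N.
have [e0|e0] := posnP (h + 2 * k + f).
  have [h0 k0 f0] : [/\ h = 0, k = 0 & f = 0] by split; lia.
  rewrite /N {N en e0} h0 k0 f0.
  by case: c; rewrite /weak_comps /= !bin0 ?muln0 ?addn0 ?muln1 ?mul1n.
rewrite -open_involutionsS //; case: c; last by rewrite mul0n !addn0.
rewrite mul1n addn1; case: leqP => en'.
  rewrite -mulnDl; congr (_ * _).
  by rewrite /N subSn // weak_compsS addnC.
have -> : N = 0 by lia.
by rewrite !weak_comps0 addn0.
Qed.

(** The bounds are free because [weight] vanishes beyond [n]; the induction needs this, since
    shifting [k] or [f] lowers a bound by one. *)
Lemma path_countE n h c K F : n < K -> n < F ->
  path_count n h c = \sum_(k < K) \sum_(f < F) weight n h k f c.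
Proof.
elim: n h c K F => [|n IHn] h c [//|K] [//|F] nK nF /=.
  rewrite !big_ord_recl /= [X in _ + X + _]big1 ?[X in _ + X]big1 => [|i _|i _].
  - rewrite !addn0 /weight muln0 !addn0 leqn0 sub0n; case: eqP => // ->.
    by rewrite weak_comps0 /open_involutions /open_matchings bin0 /odd_dfact.
  - by rewrite big1 // => j _; rewrite weight_gt // /bump /=; lia.
  - by rewrite weight_gt // /bump /=; lia.
under eq_bigr => k _ do under eq_bigr => f _ do rewrite weightS.
under eq_bigr => k _ do rewrite !big_split /= -!big_distrr /=.
have [nK1 nF1] : n < K.+1 /\ n < F.+1 by lia.
rewrite !big_split /= -!big_distrr /= -!IHn //.
congr (_ + _ + _ + _).
- rewrite (IHn h false K.+1 F) //.
  apply: eq_bigr => k _; rewrite big_ord_recl /= add0n.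
  by apply: eq_bigr => f _; rewrite mul1n.
rewrite (IHn _ _ K F.+1) //.
rewrite big_ord_recl /= mul0n add0n.
by apply: eq_bigr => k _; rewrite mul1n.
Qed.

Lemma path_count_closed n :
  path_count n 0 false =
  1 + \sum_(1 <= k < (n %/ 2).+1) \sum_(0 <= f < (n - 2 * k).+1)
        'C(n - f - k - 1, k - 1) * 'C(2 * k + f, f) * odd_dfact k.
Proof.
rewrite (path_countE _ _ _ n.+1 n.+1) //.
rewrite -(big_mkord xpredT (fun k => \sum_(f < n.+1) weight n 0 k f false)).
rewrite big_ltn //; congr (_ + _).
  (* For [k = 0] there is no interval to prolong, so only [f = n], the partition into singletons,
     contributes. *)
  rewrite big_ord_recr big1 => [|f _] /=.
    rewrite /weight !add0n leqnn subnn weak_comps0 /open_involutions binn.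
    by rewrite /open_matchings /odd_dfact.
  by rewrite /weight muln0 !add0n; case: ifP => // _;
    rewrite /weak_comps /= eqn0Ngt subn_gt0 ltn_ord.
rewrite (big_cat_nat (n := (n %/ 2).+1)) //=; last by lia.
rewrite [X in _ + X]big_nat_cond [X in _ + X]big1 ?addn0; last first.
  by move=> k kn; rewrite big1 // => f _; apply: weight_gt; lia.
rewrite 2!big_nat; apply: eq_bigr => k kn.
rewrite -(big_mkord xpredT (fun f => weight n 0 k f false)).
rewrite (big_cat_nat (n := (n - 2 * k).+1)) //=; last by lia.
rewrite [X in _ + X]big_nat_cond [X in _ + X]big1 ?addn0; last first.
  by move=> f fn; apply: weight_gt; lia.
rewrite 2!big_nat; apply: eq_bigr => f fn; rewrite /weight ifT; last by lia.
rewrite -mulnA; congr (_ * _).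
  case: k kn fn => // k kn fn; rewrite !addn0 /weak_comps; congr 'C(_, _); lia.
by rewrite /open_involutions /open_matchings addn0 bin0 !mul1n.
Qed.

Theorem theorem4p13 (n : nat) (hn : 1 <= n) :
  #|avoiders n pat134_2| =
  1 + \sum_(1 <= k < (n %/ 2).+1) \sum_(0 <= f < (n - 2 * k).+1)
        'C(n - f - k - 1, k - 1) * 'C(2 * k + f, f) * odd_dfact k.
Proof.
rewrite (eq_card (avoiders_words n hn)).
have -> : #|[seq label_partition n s | s <- words n]| = size (words n).
  rewrite -(size_map (label_partition n)); apply/card_uniqP.
  by rewrite map_inj_in_uniq ?uniq_words //; apply: label_partition_inj.
(* The empty word has no singleton, so only [h = 0] remains. *)
rewrite size_words (grow_countE _ _ _ 1) // big_ord1 bin0 mul1n.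
exact: path_count_closed.
Qed.
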